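(* Let $t\geq 4$ and $n\geq 400t^{6}$ be integers. If $G$ is a graph of order $n$ such that $K_{2,t}$ is not a minor of $G$, then $$\mu(G)\leq \frac{t-1}{2}+\sqrt{n+\frac{t^{2}-2t-3}{4}}.$$ Equality holds if and only if $n\equiv 1 \pmod t$ and $G=F_t(n)$ (up to isomorphism).
   Context: Graphs are finite, simple and undirected; the order of a graph is its number of vertices. A graph $H$ is a minor of a graph $G$ if $H$ can be obtained by contracting edges of a subgraph of $G$. $K_{a,b}$ is the complete bipartite graph with parts of sizes $a$ and $b$, and $K_m$ is the complete graph on $m$ vertices. The spectral radius $\mu(G)$ is the largest eigenvalue of the adjacency matrix of $G$. For graphs $F$ and $H$, $F\vee H$ denotes their join, $F+H$ their disjoint union, and $pH$ the disjoint union of $p$ copies of $H$. The graph $F_t(n)$, for $t\geq 3$ and $n\geq t+1$: set $p=\lfloor (n-1)/t\rfloor$ and write $n-1=pt+s$ with $0\leq s\leq t-1$; then $F_t(n):=K_1\vee(pK_t+K_s)$, where for $s=0$ (i.e. $n\equiv 1 \pmod t$) this means $F_t(n):=K_1\vee pK_t$. *)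

(* Defs.v *)
From HB Require Import structures.
From mathcomp Require Import all_boot all_order all_algebra.
From mathcomp Require Import complex polyrcf.
From mathcomp Require Import boolp classical_sets reals.

Set Implicit Arguments.
Unset Strict Implicit.
Unset Printing Implicit Defensive.

Import Order.TTheory GRing.Theory Num.Theory.

Record sgraph := SGraph {
  vertex :> finType;
  edge : rel vertex;
  edge_sym : symmetric edge;
  edge_irrefl : irreflexive edge }.

Definition giso (G H : sgraph) : Prop :=
  exists2 f : G -> H, bijective f & forall x y, edge (f x) (f y) = edge x y.

(* S is (isomorphic to) a not necessarily induced subgraph of G. *)
Definition subgraph (S G : sgraph) : Prop :=
  exists2 f : S -> G, injective f & forall x y, edge x y -> edge (f x) (f y).

Section Contraction.
Variables (G : sgraph) (u v : G).

(* The merged vertex is represented by u, and v is removed.  The first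
   conjunct discards the loop, and parallel edges are identified. *)
Definition contract_edge : rel {x : G | x != v} :=
  fun x y => (val x != val y) &&
    [|| edge (val x) (val y),
        (val x == u) && edge v (val y) |
        (val y == u) && edge v (val x)].

Lemma contract_edge_sym : symmetric contract_edge.
Proof.
move=> x y; rewrite /contract_edge eq_sym (edge_sym (val x)).
by congr (_ && (_ || _)); rewrite orbC.
Qed.

Lemma contract_edge_irrefl : irreflexive contract_edge.
Proof. by move=> x; rewrite /contract_edge eqxx. Qed.

Definition contract := SGraph contract_edge_sym contract_edge_irrefl.

End Contraction.

Inductive contracts_to (H : sgraph) : sgraph -> Prop :=
| ContractsIso (G : sgraph) : giso G H -> contracts_to H G
| ContractsStep (G : sgraph) (u v : G) :
    edge u v -> contracts_to H (contract u v) -> contracts_to H G.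

Definition minor (H G : sgraph) : Prop :=
  exists2 S : sgraph, subgraph S G & contracts_to H S.

Section Complete.
Variable m : nat.

Definition complete_edge : rel 'I_m := fun x y => x != y.

Lemma complete_edge_sym : symmetric complete_edge.
Proof. by move=> x y; rewrite /complete_edge eq_sym. Qed.

Lemma complete_edge_irrefl : irreflexive complete_edge.
Proof. by move=> x; rewrite /complete_edge eqxx. Qed.

Definition complete := SGraph complete_edge_sym complete_edge_irrefl.

End Complete.

Section CompleteBipartite.
Variables a b : nat.

Definition bipartite_edge : rel ('I_a + 'I_b)%type := fun x y =>
  match x, y with
  | inl _, inr _ | inr _, inl _ => true
  | _, _ => false
  end.

Lemma bipartite_edge_sym : symmetric bipartite_edge.
Proof. by case=> x [] y. Qed.

Lemma bipartite_edge_irrefl : irreflexive bipartite_edge.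
Proof. by case. Qed.

Definition complete_bipartite :=
  SGraph bipartite_edge_sym bipartite_edge_irrefl.

End CompleteBipartite.

Section JoinUnion.
Variables F H : sgraph.

(* [cross] tells whether vertices of F are adjacent to vertices of H. *)
Definition sum_edge (cross : bool) : rel (F + H)%type := fun x y =>
  match x, y with
  | inl x, inl y => edge x y
  | inr x, inr y => edge x y
  | _, _ => cross
  end.

Lemma sum_edge_sym cross : symmetric (sum_edge cross).
Proof. by case=> x [] y //=; rewrite edge_sym. Qed.

Lemma sum_edge_irrefl cross : irreflexive (sum_edge cross).
Proof. by case=> x /=; rewrite edge_irrefl. Qed.

Definition disjoint_union :=
  SGraph (sum_edge_sym false) (sum_edge_irrefl false).

Definition join := SGraph (sum_edge_sym true) (sum_edge_irrefl true).

End JoinUnion.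

Section Copies.
Variables (p : nat) (H : sgraph).

Definition copies_edge : rel ('I_p * H)%type :=
  fun x y => (x.1 == y.1) && edge x.2 y.2.

Lemma copies_edge_sym : symmetric copies_edge.
Proof. by move=> x y; rewrite /copies_edge eq_sym edge_sym. Qed.

Lemma copies_edge_irrefl : irreflexive copies_edge.
Proof. by move=> x; rewrite /copies_edge edge_irrefl andbF. Qed.

Definition copies := SGraph copies_edge_sym copies_edge_irrefl.

End Copies.

(* When t divides n - 1 the last summand is the graph on no vertices, so the
   result is isomorphic to K_1 \/ p K_t. *)
Definition Fgraph (t n : nat) : sgraph :=
  join (complete 1)
    (disjoint_union (copies (n.-1 %/ t) (complete t)) (complete (n.-1 %% t))).

Local Open Scope ring_scope.

Definition adjacency (R : realType) (G : sgraph) : 'M[R]_#|G| :=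
  \matrix_(i, j) (edge (enum_val i) (enum_val j))%:R.

(* The supremum is attained, i.e. it is the largest eigenvalue, as soon as G
   has a vertex: see [spectral_radius_max]. *)
Definition spectral_radius (R : realType) (G : sgraph) : R :=
  sup [set a : R | eigenvalue (adjacency R G) a]%classic.

Lemma adjacency_sym (R : realType) (G : sgraph) :
  (adjacency R G)^T = adjacency R G.
Proof. by apply/matrixP=> i j; rewrite !mxE edge_sym. Qed.

Lemma symmetric_eigenvalue (R : realType) n (A : 'M[R]_n) :
  (0 < n)%N -> A^T = A -> exists a, eigenvalue A a.
Proof.
move=> n_gt0 symA; pose B := map_mx (real_complex R) A.
have [a Ba] := eigenvalue_closed B n_gt0.
have [v /= vB v0] := eigenvalueP Ba.
pose w := map_mx Num.conj v.
have wB : w *m B = a^* *: w.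
  have <- : map_mx Num.conj B = B.
    apply/matrixP=> i j; rewrite !mxE.
    by apply/eqP; rewrite eq_complex /= oppr0 !eqxx.
  by rewrite /w -map_mxM vB map_mxZ.
have symB : B^T = B by rewrite /B map_trmx symA.
have wBT : B *m w^T = a^* *: w^T by rewrite -{1}symB -trmx_mul wB linearZ.
have nz : (v *m w^T) 0 0 != 0.
  rewrite mxE psumr_neq0 => [|i _]; last by rewrite !mxE mul_conjC_ge0.
  have [i vi0] : exists i, v 0 i != 0 by apply/rV0Pn.
  by apply/hasP; exists i; rewrite ?mem_index_enum // !mxE mul_conjC_gt0.
have : a *: (v *m w^T) = a^* *: (v *m w^T).
  by rewrite scalemxAl -vB -mulmxA wBT -scalemxAr.
move/matrixP/(_ 0 0); rewrite [LHS]mxE [RHS]mxE => /(mulIf nz) aR.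
have {aR} aE : a = real_complex R (complex.Re a).
  case: a aR {Ba vB wB wBT} => x y [] /eqP.
  by rewrite -addr_eq0 -mulr2n mulrn_eq0 /= => /eqP ->.
exists (complex.Re a); move: Ba; rewrite !eigenvalue_root_char aE.
by rewrite /B -map_char_poly fmorph_root.
Qed.

Lemma spectral_radius_max (R : realType) (G : sgraph) : (0 < #|G|)%N ->
  eigenvalue (adjacency R G) (spectral_radius R G) /\
  forall a, eigenvalue (adjacency R G) a -> a <= spectral_radius R G.
Proof.
move=> G_gt0; rewrite /spectral_radius; set A := adjacency R G.
have [a0 Aa0] := symmetric_eigenvalue G_gt0 (adjacency_sym R G).
have p0 : char_poly A != 0 by rewrite monic_neq0 // char_poly_monic.
set s := rootsR (char_poly A).
have sE a : (a \in s) = eigenvalue A a.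
  by rewrite eigenvalue_root_char -roots_on_rootsR // in_itv.
pose m := foldr Num.max a0 s.
have ms : m \in a0 :: s.
  rewrite /m; elim: (s) => [|b r IH] /=; first by rewrite mem_head.
  rewrite maxEle; case: ifP => _; last by rewrite !inE eqxx orbT.
  by move: IH; rewrite !inE => /orP[->|->]; rewrite ?orbT.
have Am : eigenvalue A m.
  by move: ms; rewrite inE sE => /orP[/eqP->|].
have le_m a : eigenvalue A a -> a <= m.
  rewrite -sE /m; elim: (s) => [|b r IH] //=.
  by rewrite inE le_max => /orP[/eqP->|/IH->]; rewrite ?lexx ?orbT.
have -> : sup [set a : R | eigenvalue A a]%classic = m.
  apply/le_anti/andP; split; first by apply: ge_sup => //; exists m.
  by apply: ub_le_sup => //; exists m.
by [].
Qed.

(* Main.v *)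
Require Import Defs.
From mathcomp Require Import all_boot all_order all_algebra reals.
From mathcomp Require Import zify ring lra.

(* Let [mu >= bound] be an eigenvalue, [x] the entrywise absolute value of an
   eigenvector scaled to have maximum 1, reached at [z], so that
   [mu x <= A x].  A graph [G] without [K_{2,t}] minor has fewer than [t]
   common neighbours for any two vertices and, contracting edges one at a time,
   at most [t n] edges.  Hence the entries of [x] have a sum [T] of order
   [t sqrt n]; since [mu^2 x <= A^2 x], the vertex [z] misses at most
   [(t - 1) T] vertices, and each [u] that it misses has [(t - 1) x_u < 1].
   Summing [mu x <= A x] over the neighbours of [z] then gives
   [mu (mu - (t - 1)) <= n - 1], that is [mu <= bound], and equality forces [z]
   to be joined to all of a (t-1)-regular graph.  In that graph, contracting
   one edge already shows that the closed neighbourhoods are the components,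
   so they are copies of [K_t]. *)

Set Implicit Arguments.
Unset Strict Implicit.
Unset Printing Implicit Defensive.

Import Order.TTheory GRing.Theory Num.Theory.

(** * Isomorphisms and minors under edge contraction *)

Lemma giso_refl (G : sgraph) : giso G G.
Proof. by exists id => //; exists id. Qed.

Lemma giso_trans (G H K : sgraph) : giso G H -> giso H K -> giso G K.
Proof.
move=> [f bf ef] [g bg eg]; exists (g \o f); first exact: bij_comp.
by move=> x y /=; rewrite eg ef.
Qed.

Lemma giso_sym (G H : sgraph) : giso G H -> giso H G.
Proof.
move=> [f [g fK gK] ef]; exists g; first by exists f.
by move=> x y; rewrite -ef !gK.
Qed.

Lemma giso_contract (G H : sgraph) (f : G -> H) (u v : G) : bijective f ->
  (forall x y, edge (f x) (f y) = edge x y) ->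
  giso (contract u v) (contract (f u) (f v)).
Proof.
move=> bf ef; have injf := bij_inj bf.
have pf (x : contract u v) : f (val x) != f v by rewrite (inj_eq injf) (valP x).
pose h (x : contract u v) : contract (f u) (f v) :=
  exist _ (f (val x)) (pf x).
have hE x : val (h x) = f (val x) by [].
exists h; last first.
  by move=> x y; rewrite /edge /= /contract_edge !hE !(inj_eq injf) !ef.
case: bf => g fK gK.
have pg (y : contract (f u) (f v)) : g (val y) != v.
  by rewrite -(inj_eq injf) gK (valP y).
by exists (fun y => exist _ (g (val y)) (pg y)) => [x|y]; apply: val_inj;
  rewrite /= ?fK ?gK.
Qed.

Lemma contracts_to_giso (H G1 G2 : sgraph) :
  giso G1 G2 -> contracts_to H G2 -> contracts_to H G1.
Proof.
move=> iso12 cH; elim: cH G1 iso12 => {G2} [G2 isoH|G2 u v uv _ IH] G1 iso12.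
  by apply: ContractsIso; apply: giso_trans isoH.
have [g [f gK fK] eg] := giso_sym iso12.
apply: (@ContractsStep _ _ (g u) (g v)); first by rewrite eg.
apply: IH; apply: giso_sym; apply: giso_contract eg.
by exists f.
Qed.

Lemma subgraph_minor (H G : sgraph) : subgraph H G -> minor H G.
Proof. by exists H => //; apply/ContractsIso/giso_refl. Qed.

Section Uncontract.
Variables (G S : sgraph) (v : G) (f : S -> G) (s0 : S).

(** Lifts a subgraph [S] of [contract u v]: [s0] sits at [u] and the new vertex [None] at [v]. Edges
    of [S] present in [G] are kept, and the edges at [s0] that [v] provides are given to [None]. *)
Definition uncontract_edge : rel (option S) := fun x y =>
  match x, y with
  | Some a, Some b => edge a b && edge (f a) (f b)
  | Some a, None => (a == s0) || edge s0 a && edge v (f a)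
  | None, Some a => (a == s0) || edge s0 a && edge v (f a)
  | None, None => false
  end.

Lemma uncontract_edge_sym : symmetric uncontract_edge.
Proof. by case=> [a|] [b|] //=; rewrite edge_sym (edge_sym (f a)). Qed.

Lemma uncontract_edge_irrefl : irreflexive uncontract_edge.
Proof. by case=> [a|] //=; rewrite edge_irrefl. Qed.

Definition uncontract := SGraph uncontract_edge_sym uncontract_edge_irrefl.

End Uncontract.

(** [minor] takes a subgraph first and contracts afterwards, so the subgraph [S] of [contract u v]
    is pulled back to [G] by [uncontract]; contracting the edge from [s0] to [None] gives [S]
    again. *)
Lemma minor_contract (H G : sgraph) (u v : G) :
  edge u v -> minor H (contract u v) -> minor H G.
Proof.
move=> uv [S [f injf ef] cS].
pose g s := val (f s).
have injg : injective g by move=> a b /val_inj /injf.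
have gv s : g s != v := valP (f s).
have uDv : u != v by apply: contraTneq uv => ->; rewrite edge_irrefl.
have eg a b : edge a b -> (g a != g b) && [|| edge (g a) (g b),
    (g a == u) && edge v (g b) | (g b == u) && edge v (g a)] by move/ef.
(* If no vertex of [S] sits at [u], the edges of [S] are already edges of [G]. *)
have [s0 /eqP gs0|no_u] := pickP (fun s => g s == u); last first.
  exists S => //; exists g => // a b /eg.
  by rewrite !no_u !orbF => /andP[].
exists (uncontract v g s0).
  exists (fun o : option S => if o is Some s then g s else v).
    move=> [a|] [b|] //=; first by move/injg ->.
      by move/eqP; rewrite (negPf (gv a)).
    by move/eqP; rewrite eq_sym (negPf (gv b)).
  move=> [a|] [b|] //=; first by case/andP.
    rewrite (edge_sym (g a)) => /orP[/eqP ->|/andP[]//].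
    by rewrite gs0 edge_sym.
  by move=> /orP[/eqP ->|/andP[]//]; rewrite gs0 edge_sym.
apply: (@ContractsStep _ (uncontract v g s0) (Some s0) None).
  by rewrite /= eqxx.
apply: contracts_to_giso cS.
apply: giso_sym.
pose h (s : S) : contract (G := uncontract v g s0) (Some s0) None :=
  exist _ (Some s) isT.
exists h.
  exists (fun x => odflt s0 (val x)) => [//|[[s|] //= p]].
  exact: val_inj.
move=> a b.
have -> : edge (h a) (h b) = (a != b) &&
  [|| edge a b && edge (g a) (g b),
      (a == s0) && ((b == s0) || edge s0 b && edge v (g b)) |
      (b == s0) && ((a == s0) || edge s0 a && edge v (g a))] by [].
have [->|aDb /=] := eqVneq a b; first by rewrite edge_irrefl.
apply/idP/idP => [/or3P[/andP[]//|/andP[/eqP as0 /orP[/eqP bs0|/andP[]]]|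
                        /andP[/eqP bs0 /orP[/eqP as0|/andP[]]]]|ab].
- by rewrite as0 bs0 eqxx in aDb.
- by rewrite as0.
- by rewrite as0 bs0 eqxx in aDb.
- by rewrite bs0 edge_sym.
have /andP[_ /or3P[->|/andP[ga vb]|/andP[gb va]]] := eg _ _ ab.
- by rewrite ab.
- have as0 : a = s0 by apply: injg; rewrite gs0; apply/eqP.
  by rewrite -as0 eqxx vb ab !orbT.
- have bs0 : b = s0 by apply: injg; rewrite gs0; apply/eqP.
  by rewrite -bs0 eqxx va (edge_sym b) ab !orbT.
Qed.

(** * Codegrees that force a [K_{2,t}] minor *)

Definition nbr (G : sgraph) (x : G) : {set G} := [set y | edge x y].

Lemma codegree_minor (t : nat) (G : sgraph) (u v : G) : u != v ->
  t <= #|nbr u :&: nbr v| -> minor (complete_bipartite 2 t) G.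
Proof.
move=> uDv tle; apply: subgraph_minor.
pose g (j : 'I_t) : G := enum_val (widen_ord tle j).
have gP j : edge u (g j) && edge v (g j).
  by have := enum_valP (widen_ord tle j); rewrite !inE.
have gu j : g j != u.
  by have /andP[+ _] := gP j; apply: contraTneq => ->; rewrite edge_irrefl.
have gv j : g j != v.
  by have /andP[_] := gP j; apply: contraTneq => ->; rewrite edge_irrefl.
exists (fun x : 'I_2 + 'I_t => match x with
  | inl i => if i == 0 :> nat then u else v | inr j => g j end).
  move=> [i|i] [j|j].
  - case: i j => [[|[|//]] ?] [[|[|//]] ?] /=;
      do ?[by move=> _; congr inl; apply: val_inj].
      by move/eqP; rewrite (negPf uDv).
    by move/eqP; rewrite eq_sym (negPf uDv).
  - by case: ifP => _ /eqP; rewrite eq_sym (negPf (gu _), negPf (gv _)).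
  - by case: ifP => _ /eqP; rewrite (negPf (gu _), negPf (gv _)).
  - by move/enum_val_inj/(congr1 val) => /= ij; congr inr; apply: val_inj.
move=> [i|i] [j|j] //= _; first by case: ifP; have /andP[] := gP j.
by rewrite edge_sym; case: ifP; have /andP[] := gP i.
Qed.

(** The counted vertices are common neighbours of [z] and the merged vertex; [a] and [b] are left
    out because they become that vertex. *)
Lemma contract_codegree_minor (t : nat) (G : sgraph) (a b z : G) :
  edge a b -> z != a -> z != b ->
  t <= #|(nbr a :|: nbr b) :&: nbr z :\: [set a; b]| ->
  minor (complete_bipartite 2 t) G.
Proof.
move=> ab zDa zDb tle; apply: (minor_contract ab).
have aDb : a != b by apply: contraTneq ab => ->; rewrite edge_irrefl.
pose a' : contract a b := exist _ a aDb.
pose z' : contract a b := exist _ z zDb.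
apply: (@codegree_minor _ _ a' z'); first by rewrite -val_eqE eq_sym.
apply: (leq_trans tle).
rewrite -(card_imset (mem (nbr a' :&: nbr z')) val_inj).
apply/subset_leq_card/subsetP => y; rewrite !inE negb_or.
move=> /andP[/andP[yDa yDb] /andP[aby zy]].
apply/imsetP; exists (exist _ y yDb : contract a b) => //.
rewrite !inE /= /contract_edge /= eqxx (eq_sym a) yDa zy /=.
have -> : z != y by apply: contraTneq zy => ->; rewrite edge_irrefl.
by rewrite orbA aby.
Qed.

(** * Edge count under contraction *)

Lemma sum_sub (T : finType) (P : pred T) (F : T -> nat) :
  \sum_(x : {x | P x}) F (val x) = \sum_(x | P x) F x.
Proof.
rewrite [RHS](reindex_omap (val : {x | P x} -> T) insub) /=.
  by apply: eq_bigl => x; rewrite valK eqxx (valP x).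
by move=> x Px; rewrite insubT.
Qed.

Lemma card_nbr_sum (G : sgraph) (x : G) : #|nbr x| = \sum_y edge x y.
Proof.
rewrite -sum1_card [RHS]big_mkcond [RHS](bigID (mem (nbr x))) /=.
rewrite [X in _ = _ + X]big1 ?addn0; last by move=> y; rewrite inE => /negPf ->.
by apply: eq_bigr => y; rewrite inE => ->.
Qed.

(** Besides [uv], each common neighbour of [u] and [v] costs one edge, as its two edges become
    parallel; a lost edge counts twice in the degree sum. *)
Lemma contract_degree_sum (G : sgraph) (u v : G) : edge u v ->
  \sum_(x : G) #|nbr x| <=
    \sum_(x : contract u v) #|nbr x| + (#|nbr u :&: nbr v|).+1.*2.
Proof.
move=> uv; have uDv : u != v by apply: contraTneq uv => ->; rewrite edge_irrefl.
(* [q] marks the neighbours that [u] gains from [v]; [c] is the edge relation of the contraction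
   read on [G], which avoids sums over the subtype. *)
pose q x := edge v x && ~~ edge u x && (x != u).
pose c x y := (x != y) && [|| edge x y, (x == u) && edge v y |
  (y == u) && edge v x].
have -> : \sum_(x : contract u v) #|nbr x| =
    \sum_(x | x != v) \sum_(y | y != v) c x y.
  rewrite -(sum_sub (fun x => x != v) (fun x => \sum_(y | y != v) c x y)).
  apply: eq_bigr => x _; rewrite card_nbr_sum.
  by rewrite -(sum_sub (fun y => y != v) (fun y => c (val x) y)).
have cle x y : edge x y + (x == u) * q y + (y == u) * q x <= c x y.
  rewrite /c /q; have [->|xDy] := eqVneq x y.
    by rewrite edge_irrefl; case: eqVneq; rewrite ?andbF ?andbT.
  case: (eqVneq x u) => [xu|]; case: (eqVneq y u) => [yu|] /=;
    rewrite ?andbF ?andbT ?orbF ?mul0n ?mul1n ?addn0 //.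
  - by rewrite xu yu eqxx in xDy.
  - by rewrite xu; case: edge; case: edge.
  - by rewrite yu (edge_sym u); case: edge; case: edge.
have sumE : \sum_(x | x != v) \sum_(y | y != v) edge x y +
    (\sum_(y | y != v) q y).*2 <= \sum_(x | x != v) \sum_(y | y != v) c x y.
  have : \sum_(x | x != v) \sum_(y | y != v)
      (edge x y + (x == u) * q y + (y == u) * q x) <=
      \sum_(x | x != v) \sum_(y | y != v) c x y.
    by apply: leq_sum => x _; apply: leq_sum => y _; apply: cle.
  apply: leq_trans.
  rewrite [X in _ <= X](eq_bigr (fun x => \sum_(y | y != v) edge x y +
    (x == u) * \sum_(y | y != v) q y + q x)); last first.
    move=> x xv; rewrite !big_split /= big_distrr /=; congr (_ + _).
    by rewrite (bigD1 u) //= eqxx mul1n big1 ?addn0 // => y /andP[_ /negPf ->].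
  rewrite !big_split /= -addnA leq_add2l -addnn leq_add2r.
  by rewrite [X in _ <= X](bigD1 u) //= eqxx mul1n leq_addr.
(* The successor accounts for [u] itself, a neighbour of [v] that is neither marked by [q] nor a
   common neighbour. *)
have degv : #|nbr v| = \sum_(y | y != v) q y + (#|nbr u :&: nbr v|).+1.
  have -> : \sum_(y | y != v) q y = #|nbr v :\: nbr u :\ u|.
    rewrite -sum1_card big_mkcond [RHS]big_mkcond /=; apply: eq_bigr => y _.
    rewrite !inE /q; case: (eqVneq y v) => [->|_].
      by rewrite edge_irrefl !andbF.
    by rewrite andbC [~~ _ && edge v y]andbC; case: (_ && _).
  have := cardsID (nbr u) (nbr v); have := cardsD1 u (nbr v :\: nbr u).
  rewrite !inE edge_irrefl edge_sym uv setIC; lia.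
have EG : \sum_(x : G) #|nbr x| =
    \sum_(x | x != v) \sum_(y | y != v) edge x y + #|nbr v|.*2.
  rewrite -addnn (bigD1 v) //= [RHS]addnA [RHS]addnC; congr (_ + _).
  rewrite (eq_bigr (fun x => \sum_(y | y != v) edge x y + edge x v)).
    rewrite big_split /=; congr (_ + _).
    rewrite card_nbr_sum [RHS](bigD1 v) //= edge_irrefl add0n.
    by apply: eq_bigr => y _; rewrite edge_sym.
  by move=> x _; rewrite card_nbr_sum (bigD1 v) //= addnC.
by rewrite EG degv; lia.
Qed.

(* Contracting [uv] loses [1 + codegree u v] edges, and the codegree is at most
   [t - 1], so a graph without [K_{2,t}] minor has at most [t] edges per
   vertex. *)
Lemma degree_sum_le (t : nat) (G : sgraph) :
  ~ minor (complete_bipartite 2 t) G -> \sum_(x : G) #|nbr x| <= 2 * t * #|G|.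
Proof.
have [k] := ubnP #|G|; elim: k G => // k IH G ltk noK.
have [[u v] /= uv|noE] := pickP (fun p : G * G => edge p.1 p.2); last first.
  rewrite big1 // => x _; apply/eqP; rewrite cards_eq0; apply/eqP/setP => y.
  by rewrite !inE (noE (x, y)).
have uDv : u != v by apply: contraTneq uv => ->; rewrite edge_irrefl.
have codeg : #|nbr u :&: nbr v| < t.
  by rewrite ltnNge; apply/negP => /(codegree_minor uDv).
have cardC : #|contract u v| = #|G|.-1.
  by rewrite card_sig -(cardC1 v).
have G_gt0 : 0 < #|G| by apply/card_gt0P; exists u.
have := IH (contract u v); rewrite cardC => IHc.
have {}IHc : \sum_(x : contract u v) #|nbr x| <= 2 * t * #|G|.-1.
  by apply: IHc; [rewrite prednK | move/(minor_contract uv)].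
apply: (leq_trans (contract_degree_sum uv)).
have EG : #|G| = #|G|.-1.+1 by rewrite prednK.
by rewrite EG; move: IHc codeg; nia.
Qed.

(** * Cones over a (t-1)-regular graph *)

Section RegularCone.
Variables (t : nat) (G : sgraph) (z : G).
Hypothesis t_ge4 : 4 <= t.
Hypothesis noK : ~ minor (complete_bipartite 2 t) G.
Hypothesis cone : forall v, v != z -> edge z v.
Hypothesis regular : forall v, v != z -> #|nbr z :&: nbr v| = t.-1.

(** As [z] is joined to all other vertices, this is the neighbourhood of [v] in [G] minus [z]. *)
Let D v := nbr z :&: nbr v.

Lemma mem_link v w : (w \in D v) = (w != z) && edge v w.
Proof.
rewrite !inE; congr (_ && _); case: eqVneq => [->|/cone //].
by rewrite edge_irrefl.
Qed.

(** After contracting [ab], the merged vertex shares with [z] the [t - 2] vertices of [D a] other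
    than [b], and also the set bounded here. A total of [t] would give a minor. *)
Lemma link_diff_le1 a b : a != z -> b != z -> edge a b ->
  #|D b :\: nbr a :\ a| <= 1.
Proof.
move=> az bz ab.
have aDb : a != b by apply: contraTneq ab => ->; rewrite edge_irrefl.
have lt_t : #|(nbr a :|: nbr b) :&: nbr z :\: [set a; b]| < t.
  rewrite ltnNge; apply/negP.
  by move/(contract_codegree_minor ab); rewrite ![z == _]eq_sym => /(_ az bz).
set Q := D b :\: nbr a :\ a.
have dis : (D a :\ b) :&: Q = set0.
  by apply/setP => y; rewrite !inE; case: (edge a y); rewrite ?andbF.
have sub : (D a :\ b) :|: Q \subset (nbr a :|: nbr b) :&: nbr z :\: [set a; b].
  apply/subsetP => y; rewrite !inE negb_or.
  have [->|yDa] := eqVneq y a; first by rewrite edge_irrefl !andbF.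
  have [->|yDb] := eqVneq y b; first by rewrite edge_irrefl !andbF.
  by case: (edge z y); case: (edge a y); case: (edge b y).
have := subset_leq_card sub; have := cardsD1 b (D a).
rewrite cardsU dis cards0 mem_link bz ab regular //=; lia.
Qed.

Lemma link_diff_eq a b w1 w2 : a != z -> b != z -> edge a b ->
  w1 \in D b -> w2 \in D b -> w1 != a -> w2 != a ->
  ~~ edge a w1 -> ~~ edge a w2 -> w1 = w2.
Proof.
move=> az bz ab Dw1 Dw2 w1a w2a aw1 aw2.
apply: (card_le1_eqP (link_diff_le1 az bz ab)).
  by rewrite in_setD1 w2a in_setD Dw2 inE aw2.
by rewrite in_setD1 w1a in_setD Dw1 inE aw1.
Qed.

(** Otherwise the common neighbours [Y] of [u] and [w] away from [z] are closed under adjacency, up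
    to [u] and [w], yet too few to cover [D u]. A neighbour [u'] of [u] outside [Y] is nevertheless
    adjacent to some vertex of [Y]. *)
Lemma edge_link_trans u v w : u != z -> edge u v -> w \in D v -> v != z ->
  w != u -> edge u w.
Proof.
move=> uz uv wv vz wDu; apply/negPn/negP => uw.
have wz : w != z by move: wv; rewrite mem_link => /andP[].
have vw : edge v w by move: wv; rewrite mem_link => /andP[].
pose Y := D u :&: D w.
have memY y : (y \in Y) = [&& y != z, edge u y & edge w y].
  by rewrite inE !mem_link; case: (y != z); case: (edge u y).
have vY : v \in Y by rewrite memY vz uv edge_sym.
(* Apart from [u] itself, [u] misses at most one vertex of [D y], and [w] is that one; the same
   holds with [u] and [w] exchanged. *)
have closed y q : y \in Y -> q \in D y -> q != u -> q != w -> q \in Y.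
  rewrite memY => /and3P[yz uy wy] qy qu qw.
  have [qz yq] : q != z /\ edge y q by move: qy; rewrite mem_link => /andP.
  have uDy : u \in D y by rewrite mem_link uz edge_sym.
  have wDy : w \in D y by rewrite mem_link wz edge_sym.
  rewrite memY qz /=; apply/andP; split; apply/negPn/negP => nq.
    by move/eqP: qw; apply; apply: (@link_diff_eq u y).
  move/eqP: qu; apply; apply: (@link_diff_eq w y) => //.
    by rewrite eq_sym.
  by rewrite edge_sym.
have geY : t.-2 <= #|Y|.
  have sub : v |: (D v :\ u :\ w) \subset Y.
    apply/subsetP => y; rewrite in_setU1 => /predU1P[->//|].
    by rewrite !in_setD1 => /and3P[yw yu yv]; apply: (closed v).
  apply: leq_trans (subset_leq_card sub).
  have := cardsD1 w (D v :\ u); have := cardsD1 u (D v).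
  rewrite cardsU1 !in_setD1 !mem_link edge_irrefl wz wDu uz vw edge_sym uv.
  by rewrite regular //= !andbF; lia.
(* [z] is one more common neighbour of [u] and [w], which makes the bound strict. *)
have leY : #|Y| < t.-1.
  have : #|nbr u :&: nbr w| < t.
    by rewrite ltnNge; apply/negP; apply: contra_not noK;
      apply: codegree_minor; rewrite eq_sym.
  have : #|z |: Y| <= #|nbr u :&: nbr w|.
    apply/subset_leq_card/subsetP => y; rewrite in_setU1 memY !inE.
    by case/predU1P => [->|/and3P[_ -> ->]//]; rewrite !(edge_sym _ z) !cone.
  by rewrite cardsU1 memY eqxx; lia.
have /subsetPn[u' u'u u'Y] : ~~ (D u \subset Y).
  by apply: contraTN leY => /subset_leq_card; rewrite regular // -leqNgt.
have [u'z uu'] : u' != z /\ edge u u' by move: u'u; rewrite mem_link => /andP.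
(* Apart from itself, [u'] misses at most one vertex of [D u], while [Y] has at least [t - 2 >= 2]
   of them: here [4 <= t] matters. *)
have /subsetPn[y yY] : ~~ (Y \subset D u :\: nbr u' :\ u').
  apply/negP => /subset_leq_card.
  have := link_diff_le1 u'z uz; rewrite edge_sym => /(_ uu').
  by move: geY t_ge4; lia.
have [yz uy wy] : [/\ y != z, edge u y & edge w y].
  by apply/and3P; rewrite -memY.
rewrite in_setD1 in_setD mem_link yz uy inE !andbT.
have -> : y != u' by apply: contraNneq u'Y => <-.
rewrite negbK => u'y; move/negP: u'Y; apply; apply: (closed y) => //.
- by rewrite mem_link u'z edge_sym.
- by apply: contraTneq uu' => ->; rewrite edge_irrefl.
- by apply: contraTneq uu' => ->.
Qed.

(** By [edge_link_trans], this is the component of [v] in [G] minus [z]. *)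
Let cls v := v |: D v.

Let mem_cls v w : v != z -> (w \in cls v) = (w != z) && ((w == v) || edge v w).
Proof.
by move=> vz; rewrite in_setU1 mem_link; case: eqVneq => [->|]; rewrite ?vz.
Qed.

Let cls_sub v w : v != z -> w \in cls v -> cls v \subset cls w.
Proof.
move=> vz wv; have := wv; rewrite mem_cls // => /andP[wz vw].
apply/subsetP => y; rewrite !mem_cls // => /andP[yz]; rewrite yz /=.
have [-> //|wDv] := eqVneq w v; move: vw; rewrite (negPf wDv) /= => vw.
case/predU1P => [->|vy]; first by rewrite edge_sym vw orbT.
case: eqVneq => //= yDw; apply: (@edge_link_trans w v) => //.
  by rewrite edge_sym.
by rewrite mem_link yz.
Qed.

Let cls_eq v w : v != z -> w != z -> (cls v == cls w) = (w \in cls v).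
Proof.
move=> vz wz; apply/eqP/idP => [->|wv]; first by rewrite setU11.
have vw : v \in cls w.
  by move: wv; rewrite !mem_cls // vz wz eq_sym edge_sym.
by apply/eqP; rewrite eqEsubset !cls_sub.
Qed.

Let card_cls v : v != z -> #|cls v| = t.
Proof.
by move=> vz; rewrite cardsU1 mem_link edge_irrefl andbF regular //; lia.
Qed.

Let P := [set cls v | v in ~: [set z]].

(** The closed neighbourhoods partition the vertices other than [z] into blocks of size [t]. *)
Lemma card_regular_cone : #|G|.-1 = #|P| * t.
Proof.
have <- : #|~: [set z]| = #|G|.-1 by rewrite cardsC1.
apply: card_uniform_partition.
  by move=> A /imsetP[v]; rewrite !inE => vz ->; apply: card_cls.
apply/and3P; split.
- apply/eqP/setP => w; rewrite !inE; apply/bigcupP/idP => [[A]|wz].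
    by case/imsetP=> v; rewrite !inE => vz ->; rewrite mem_cls // => /andP[].
  by exists (cls w); rewrite ?setU11 //; apply: imset_f; rewrite !inE.
- apply/trivIsetP => A B /imsetP[v + ->] /imsetP[w + ->].
  rewrite !inE => vz wz; apply: contraNT => /pred0Pn[y /= /andP[yv yw]].
  have yz : y != z by move: yv; rewrite mem_cls // => /andP[].
  have /eqP -> : cls v == cls y by rewrite cls_eq.
  by rewrite eq_sym cls_eq.
- apply/imsetP => -[v _ /setP/(_ v)]; by rewrite setU11 inE.
Qed.

Lemma giso_regular_cone : 1 < #|G| -> giso G (Fgraph t #|G|).
Proof.
move=> G_gt1; have t_gt0 : 0 < t by lia.
have pE : #|G|.-1 %/ t = #|P| by rewrite card_regular_cone mulnK.
have sE : #|G|.-1 %% t = 0 by rewrite card_regular_cone modnMl.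
have p_gt0 : 0 < #|G|.-1 %/ t.
  rewrite pE lt0n; apply: contraTneq G_gt1 => P0; rewrite -leqNgt.
  by have := card_regular_cone; rewrite P0 mul0n; lia.
(* A vertex is located by the rank of its class in [P] and its rank in that class. The [insubd]
   defaults can only concern [z], which [f] treats apart. *)
pose i v : 'I_(#|G|.-1 %/ t) :=
  insubd (Ordinal p_gt0) (index (cls v) (enum P)).
pose j v : 'I_t := insubd (Ordinal t_gt0) (index v (enum (cls v))).
have clsP v : v != z -> cls v \in P.
  by move=> vz; apply: imset_f; rewrite !inE.
have iE v : v != z -> val (i v) = index (cls v) (enum P).
  move=> vz; have lt_p : index (cls v) (enum P) < #|G|.-1 %/ t.
    by rewrite pE cardE index_mem mem_enum clsP.
  by rewrite val_insubd lt_p.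
have jE v : v != z -> val (j v) = index v (enum (cls v)).
  move=> vz; have lt_t : index v (enum (cls v)) < t.
    by rewrite -[X in _ < X](card_cls vz) cardE index_mem mem_enum setU11.
  by rewrite val_insubd lt_t.
have i_eq v w : v != z -> w != z -> (i v == i w) = (cls v == cls w).
  move=> vz wz; rewrite -val_eqE /= !iE //; apply/eqP/eqP => [|-> //].
  by apply: (index_inj set0); rewrite mem_enum clsP.
have j_eq v w : v != z -> w != z -> cls v = cls w -> (j v == j w) = (v == w).
  move=> vz wz vw; rewrite -val_eqE /= !jE // vw; apply/eqP/eqP => [|-> //].
  by apply: (index_inj z); rewrite mem_enum ?setU11 // -vw setU11.
pose f v : Fgraph t #|G| := if v == z then inl ord0 else inr (inl (i v, j v)).
have inj_f : injective f.
  move=> v w; rewrite /f; have [->|vz] := eqVneq v z.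
    by case: eqVneq => [->|].
  case: eqVneq => [//|wz] [/eqP + /eqP]; rewrite i_eq // => /eqP vw.
  by rewrite j_eq // => /eqP.
exists f.
  (* By [sE] the last summand of [Fgraph] has no vertex, so the cardinalities agree. *)
  apply: inj_card_bij => //.
  rewrite !card_sum card_prod !card_ord sE pE -card_regular_cone.
  by move: G_gt1; lia.
move=> v w; rewrite /f; have [->|vz] := eqVneq v z; have [->|wz] := eqVneq w z.
- by rewrite !edge_irrefl.
- by rewrite cone.
- by rewrite (edge_sym v z) cone.
rewrite /= /copies_edge /= i_eq //; case: eqP => [vw|/eqP].
  rewrite /= /complete_edge j_eq //.
  have /eqP := vw; rewrite cls_eq // mem_cls // wz /=.
  by case: eqVneq => [->|]; rewrite ?edge_irrefl ?eqxx //= eq_sym => /negPf ->.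
by rewrite cls_eq // mem_cls // wz negb_or => /andP[_ /negPf ->].
Qed.

Lemma modn_regular_cone : 1 < #|G| -> #|G| = 1 %[mod t].
Proof.
move=> G_gt1; have -> : #|G| = #|P| * t + 1.
  by rewrite -card_regular_cone; lia.
by rewrite modnMDl.
Qed.

End RegularCone.

(** * Walks of length two and the spectral estimate *)

Local Open Scope ring_scope.

Lemma sum_walk2 (R : realType) (G : sgraph) (x : G -> R) (v : G) :
  \sum_(w in nbr v) \sum_(y in nbr w) x y =
  \sum_y #|nbr v :&: nbr y|%:R * x y.
Proof.
under eq_bigr do rewrite big_mkcond.
rewrite exchange_big; apply: eq_bigr => y _.
rewrite -big_mkcondr /= sumr_const mulr_natl; congr (_ *+ _).
by apply: eq_card => w; rewrite [LHS]unfold_in !inE (edge_sym y).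
Qed.

Section SubEigenvector.
Variables (R : realType) (t : nat) (G : sgraph) (x : G -> R) (z : G) (mu : R).
Hypothesis t_ge2 : (2 <= t)%N.
Hypothesis G_large : (400 * t ^ 6 <= #|G|)%N.
Hypothesis noK : ~ minor (complete_bipartite 2 t) G.
Hypothesis x_ge0 : forall v, 0 <= x v.
Hypothesis x_le1 : forall v, x v <= 1.
Hypothesis xz : x z = 1.
Hypothesis mu_ge0 : 0 <= mu.
Hypothesis mu_large : #|G|%:R <= mu ^+ 2.
Hypothesis mu_sub : forall v, mu * x v <= \sum_(w in nbr v) x w.

Let k : R := t%:R - 1.
Let T := \sum_v x v.
Let U := ~: (z |: nbr z).
Let S := \sum_(v in nbr z) x v.

Let t_ge : 2 <= t%:R :> R. Proof. by rewrite ler_nat. Qed.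

Let codegree_le (a b : G) : a != b -> #|nbr a :&: nbr b|%:R <= k.
Proof.
move=> aDb; rewrite /k lerBrDr natr1 ler_nat ltnNge.
by apply/negP => le_t; exact: noK (codegree_minor aDb le_t).
Qed.

(** The constant [400 * t ^ 6] is the square of [20 * t ^ 3]. *)
Let mu_ge : 20 * t%:R ^+ 3 <= mu.
Proof.
rewrite -(@ler_pXn2r _ 2) ?nnegrE ?mulr_ge0 ?exprn_ge0 ?ler0n //.
apply: le_trans mu_large; apply: le_trans (_ : (400 * t ^ 6)%:R <= _).
  by rewrite natrM natrX; lra.
by rewrite ler_nat.
Qed.

Let mu_gt0 : 0 < mu.
Proof.
apply: lt_le_trans mu_ge; rewrite mulr_gt0 ?exprn_gt0 //.
by move: t_ge; lra.
Qed.

Let k_lt_mu : k < mu.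
Proof.
apply: lt_le_trans mu_ge; rewrite /k.
have : t%:R <= t%:R ^+ 3 :> R by rewrite ler_eXnr //; move: t_ge; lra.
by move: t_ge; lra.
Qed.

(** Summing [mu_sub] over all vertices gives [mu * T <= 2 * t * #|G| <= 2 * t * mu ^ 2], so
    [T <= 2 * t * mu]; then [mu_ge] absorbs [20 * t ^ 3]. *)
Let mass_le : 10 * t%:R ^+ 2 * T <= mu ^+ 2.
Proof.
have muT : mu * T <= mu * (2 * t%:R * mu).
  apply: le_trans (_ : \sum_(v : G) #|nbr v|%:R <= _).
    rewrite /T mulr_sumr; apply: ler_sum => v _; apply: le_trans (mu_sub v) _.
    by rewrite -sumr_const; apply: ler_sum.
  rewrite -natr_sum; apply: le_trans (_ : (2 * t * #|G|)%:R <= _).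
    by rewrite ler_nat; apply: degree_sum_le.
  rewrite !natrM mulrCA -expr2 ler_wpM2l ?mulr_ge0 ?ler0n //.
have {}muT : T <= 2 * t%:R * mu by rewrite -(ler_pM2l mu_gt0).
apply: le_trans (_ : 20 * t%:R ^+ 3 * mu <= _).
  apply: le_trans (ler_wpM2l _ muT) _.
    by rewrite mulr_ge0 ?exprn_ge0 ?ler0n.
  by rewrite le_eqVlt; apply/orP; left; apply/eqP; ring.
by rewrite expr2 ler_wpM2r.
Qed.

(** [mu_sub] is applied twice. The diagonal entries of the squared adjacency matrix are degrees, the
    others codegrees, at most [k]. *)
Let walk2 v : mu ^+ 2 * x v <= #|nbr v|%:R * x v + k * T.
Proof.
apply: le_trans (_ : \sum_y #|nbr v :&: nbr y|%:R * x y <= _).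
  rewrite -sum_walk2 expr2 -mulrA.
  apply: le_trans (ler_wpM2l mu_ge0 (mu_sub v)) _.
  by rewrite mulr_sumr; apply: ler_sum => w _; apply: mu_sub.
rewrite (bigD1 v) //= setIid lerD2l /T mulr_sumr [leRHS](bigD1 v) //=.
rewrite -[leLHS]add0r; apply: lerD.
  by rewrite mulr_ge0 // /k; move: t_ge; lra.
apply: ler_sum => y yDv; apply: ler_wpM2r => //.
by apply: codegree_le; rewrite eq_sym.
Qed.

Let card_split : #|G|%:R = 1 + #|nbr z|%:R + #|U|%:R :> R.
Proof.
have := cardsC (z |: nbr z); rewrite cardsU1 inE edge_irrefl /= -/U => <-.
by rewrite !natrD.
Qed.

(** [walk2] at [z] is compared with [#|G| <= mu ^ 2]. *)
Let card_far : #|U|%:R <= k * T.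
Proof.
by have := walk2 z; rewrite xz !mulr1; move: card_split mu_large; lra.
Qed.

(** The degree of [u] is at most [k + #|U| <= k + k * T], so [mu ^ 2 * x u <= k + 2 * k * T].
    Multiplied by [k], the right side is at most [t ^ 2 + 2 * t ^ 2 * T], a quarter of [mu ^ 2] at
    most. *)
Let far_small u : u \in U -> k * x u < 1.
Proof.
rewrite !inE negb_or => /andP[uDz Nzu].
have du : #|nbr u|%:R <= k + #|U|%:R.
  apply: le_trans (_ : #|(nbr u :&: nbr z) :|: U|%:R <= _).
    rewrite ler_nat; apply/subset_leq_card/subsetP => w; rewrite !inE => uw.
    rewrite uw; case: (edge z w); rewrite ?orbF //=.
    by apply: contraTneq uw => ->; rewrite edge_sym.
  apply: le_trans (_ : (#|nbr u :&: nbr z| + #|U|)%:R <= _).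
    by rewrite ler_nat cardsU leq_subr.
  by rewrite natrD lerD2r; apply: codegree_le.
have k_ge0 : 0 <= k by rewrite /k; move: t_ge; lra.
have T_ge0 : 0 <= T by apply: sumr_ge0.
have Mx : mu ^+ 2 * x u <= k + 2 * (k * T).
  apply: le_trans (walk2 u) _.
  have : #|nbr u|%:R * x u <= #|nbr u|%:R by rewrite ler_piMr ?ler0n.
  by move: du card_far; lra.
have M_gt0 : 0 < mu ^+ 2 by rewrite exprn_gt0.
rewrite -(ltr_pM2l M_gt0) mulr1 mulrCA.
apply: le_lt_trans (ler_wpM2l k_ge0 Mx) _.
have k2 : k ^+ 2 <= t%:R ^+ 2.
  by rewrite ler_pXn2r ?nnegrE ?ler0n // /k; move: t_ge; lra.
have t2 : 20 * t%:R ^+ 2 <= mu ^+ 2 :> R.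
  apply: le_trans (_ : 20 * t%:R ^+ 3 * mu <= _); last first.
    by rewrite expr2 ler_wpM2r.
  rewrite -[leLHS]mulr1; apply: ler_pM; rewrite ?mulr_ge0 ?exprn_ge0 ?ler0n //.
    by rewrite ler_wpM2l ?ler_weXn2l //; move: t_ge; lra.
  apply: le_trans mu_ge.
  have : 1 <= t%:R ^+ 3 :> R by rewrite exprn_ege1 //; move: t_ge; lra.
  by move: t_ge; lra.
have t2_gt0 : 0 < t%:R ^+ 2 :> R by rewrite exprn_gt0 //; move: t_ge; lra.
have k2T : k ^+ 2 * T <= t%:R ^+ 2 * T by apply: ler_wpM2r.
move: mass_le; nra.
Qed.

(* Each of the four terms other than [mu * (mu - k)] is nonnegative: together
   they measure how far [G] is from a vertex joined to a (t-1)-regular graph. *)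
Let defects :
  mu * (mu - k) + (S - mu) * (mu - k) +
    \sum_(w in nbr z) (k - #|nbr z :&: nbr w|%:R) * x w +
    \sum_(u in U) (1 - #|nbr z :&: nbr u|%:R * x u) +
    \sum_(v in nbr z) (\sum_(w in nbr v) x w - mu * x v) = #|G|%:R - 1.
Proof.
rewrite [X in _ + X = _]sumrB sum_walk2 -[X in _ + (_ - X) = _]mulr_sumr -/S.
(* The walks back to [z] contribute its degree, [#|G| - 1 - #|U|]; the other end vertices split into
   [nbr z] and [U]. *)
rewrite [X in _ + (X - _)](bigD1 z) //= setIid xz mulr1.
rewrite [X in _ + (_ + X - _)](bigID (mem (nbr z))) /=.
under [X in _ + (_ + (X + _) - _)]eq_bigl => w.
  rewrite inE; have -> : (w != z) && edge z w = edge z w.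
    by case: eqVneq => // ->; rewrite edge_irrefl.
  over.
under [X in _ + (_ + (_ + X) - _)]eq_bigl => w.
  have -> : (w != z) && (w \notin nbr z) = (w \in U).
    by rewrite !inE negb_or.
  over.
under [X in _ + X + _ + _ = _]eq_bigr do rewrite mulrBl.
rewrite !sumrB -mulr_sumr -/S sumr_const card_split.
under [X in k * S - X]eq_bigl do rewrite inE.
ring.
Qed.

Let defect_near w : w \in nbr z -> 0 <= (k - #|nbr z :&: nbr w|%:R) * x w.
Proof.
rewrite inE => zw; rewrite mulr_ge0 // subr_ge0 codegree_le //.
by apply: contraTneq zw => ->; rewrite edge_irrefl.
Qed.

Let defect_far u : u \in U -> 0 < 1 - #|nbr z :&: nbr u|%:R * x u.
Proof.
move=> uU; rewrite subr_gt0; apply: le_lt_trans (far_small uU).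
rewrite ler_wpM2r // codegree_le //.
by move: uU; rewrite !inE negb_or eq_sym => /andP[].
Qed.

Let defect_step v : 0 <= \sum_(w in nbr v) x w - mu * x v.
Proof. by rewrite subr_ge0. Qed.

Let muS : mu <= S.
Proof. by have := mu_sub z; rewrite xz mulr1. Qed.

Lemma subeigen_le : mu * (mu - (t%:R - 1)) <= #|G|%:R - 1.
Proof.
rewrite -defects -/k -!addrA lerDl.
rewrite !addr_ge0 ?mulr_ge0 ?subr_ge0 ?(ltW k_lt_mu) //.
- by apply: sumr_ge0.
- by apply: sumr_ge0 => u /defect_far/ltW.
- by apply: sumr_ge0.
Qed.

(** Equality makes every sum in [defects] vanish. The terms over [U] are strictly positive, so [U]
    is empty; the terms over [nbr z] give the codegree once [x v] is known to be positive. *)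
Lemma subeigen_eq : mu * (mu - (t%:R - 1)) = #|G|%:R - 1 ->
  forall v, v != z -> edge z v /\ #|nbr z :&: nbr v| = t.-1.
Proof.
move=> eq_mu.
have d1 : 0 <= (S - mu) * (mu - k) by rewrite mulr_ge0 ?subr_ge0 // ltW.
have d2 : 0 <= \sum_(w in nbr z) (k - #|nbr z :&: nbr w|%:R) * x w.
  exact: sumr_ge0.
have d3 : 0 <= \sum_(u in U) (1 - #|nbr z :&: nbr u|%:R * x u).
  by apply: sumr_ge0 => u /defect_far/ltW.
have d4 : 0 <= \sum_(v in nbr z) (\sum_(w in nbr v) x w - mu * x v).
  exact: sumr_ge0.
have near0 : \sum_(w in nbr z) (k - #|nbr z :&: nbr w|%:R) * x w = 0.
  by move: defects; rewrite -eq_mu -/k; lra.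
have far0 : \sum_(u in U) (1 - #|nbr z :&: nbr u|%:R * x u) = 0.
  by move: defects; rewrite -eq_mu -/k; lra.
have step0 : \sum_(v in nbr z) (\sum_(w in nbr v) x w - mu * x v) = 0.
  by move: defects; rewrite -eq_mu -/k; lra.
have domz v : v != z -> edge z v.
  move=> vDz; apply/negPn/negP => zv.
  have vU : v \in U by rewrite !inE negb_or vDz.
  have := defect_far vU.
  rewrite (psumr_eq0P _ far0) ?ltxx // => u uU.
  exact/ltW/defect_far.
move=> v vDz; have zv := domz v vDz; split=> //.
have vN : v \in nbr z by rewrite inE.
(* By [step0], [mu * x v] equals a sum of nonnegative terms that contains [x z = 1]. *)
have xv_gt0 : 0 < x v.
  have /eqP := psumr_eq0P (fun i _ => defect_step i) step0 vN.
  rewrite subr_eq0 => /eqP Ax; rewrite -(pmulr_rgt0 _ mu_gt0) -Ax.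
  rewrite (bigD1 z) ?inE 1?edge_sym //= xz ltr_pwDl ?sumr_ge0 //.
have /eqP := psumr_eq0P defect_near near0 vN.
rewrite mulf_eq0 (gt_eqF xv_gt0) orbF subr_eq0 /k => /eqP.
have -> : t%:R - 1 = t.-1%:R :> R.
  by rewrite -subn1 natrB //; apply: leq_trans t_ge2.
by move/eqP; rewrite eqr_nat => /eqP.
Qed.

End SubEigenvector.

(** * Eigenvectors as functions on the vertices, and the conclusion *)

Lemma adjacency_mul (R : realType) (G : sgraph) (y : G -> R) (v : G) :
  (\row_i y (enum_val i) *m adjacency R G) 0 (enum_rank v) =
  \sum_(w in nbr v) y w.
Proof.
rewrite mxE [RHS]big_mkcond [RHS](reindex (@enum_val G predT)) /=; last first.
  exact/onW_bij/enum_val_bij.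
apply: eq_bigr => i _; rewrite !mxE enum_rankK inE edge_sym.
by case: edge; rewrite ?mulr1 ?mulr0.
Qed.

Lemma eigenvalue_adjacencyP (R : realType) (G : sgraph) (a : R) :
  eigenvalue (adjacency R G) a <->
  exists2 y : G -> R, (exists v, y v != 0) &
    forall v, \sum_(w in nbr v) y w = a * y v.
Proof.
split=> [/eigenvalueP[r rA /rV0Pn[i ri]]|[y [v yv] yA]].
  exists (fun v => r 0 (enum_rank v)).
    by exists (enum_val i); rewrite enum_valK.
  move=> v; rewrite -adjacency_mul.
  have -> : \row_i0 r 0 (enum_rank (enum_val i0 : G)) = r.
    by apply/rowP => j; rewrite mxE enum_valK.
  by rewrite rA mxE.
apply/eigenvalueP; exists (\row_i y (enum_val i)).
  apply/rowP => i; rewrite -[i]enum_valK adjacency_mul yA !mxE.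
  by rewrite enum_valK.
by apply/rV0Pn; exists (enum_rank v); rewrite mxE enum_rankK.
Qed.

(** The triangle inequality in [A y = a y], together with [a <= |a|], stands in for
    Perron-Frobenius. *)
Lemma eigenvalue_subvector (R : realType) (G : sgraph) (a : R) :
  eigenvalue (adjacency R G) a ->
  exists (x : G -> R) (z : G), [/\ forall v, 0 <= x v, forall v, x v <= 1,
    x z = 1 & forall v, a * x v <= \sum_(w in nbr v) x w].
Proof.
move=> /eigenvalue_adjacencyP[y [v0 yv0] yA].
have [z _ zmax] :=
  @Order.TotalTheory.arg_maxP _ _ _ v0 xpredT (fun v => `|y v|) isT.
have yz : 0 < `|y z| by apply: lt_le_trans (zmax v0 isT); rewrite normr_gt0.
exists (fun v => `|y v| / `|y z|), z; split => [v|v||v].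
- by rewrite divr_ge0.
- by rewrite ler_pdivrMr // mul1r; apply: zmax.
- by rewrite divff ?gt_eqF.
rewrite -mulr_suml mulrA ler_wpM2r ?invr_ge0 //.
apply: le_trans (ler_wpM2r _ (ler_norm a)) _ => //.
by rewrite -normrM -yA; apply: ler_norm_sum.
Qed.

Lemma eigenvalue_Fgraph (R : realType) (t : nat) (G : sgraph) (a : R) :
  (1 < #|G|)%N -> #|G| = 1 %[mod t] -> giso G (Fgraph t #|G|) ->
  (1 < t)%N -> a * (a - (t%:R - 1)) = #|G|%:R - 1 ->
  eigenvalue (adjacency R G) a.
Proof.
move=> G_gt1 G1 [f bij_f ef] t_gt1 aE; set n := #|G| in G_gt1 G1 f bij_f ef aE.
have t_gt0 : (0 < t)%N by apply: ltnW.
have n_gt0 : (0 < n)%N by apply: ltnW.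
have s0 : (n.-1 %% t = 0)%N.
  have : (1 + n.-1 = 1 + 0 %[mod t])%N by rewrite add1n prednK.
  by move/eqP; rewrite eqn_modDl mod0n => /eqP.
have pt : (n.-1 %/ t * t = n.-1)%N by rewrite {2}(divn_eq n.-1 t) s0 addn0.
(* At the centre the eigenvalue equation reads [n - 1 = a * (a - (t - 1))]; elsewhere it reads
   [(a - (t - 1)) + (t - 1) = a]. *)
pose y (v : Fgraph t n) : R := if v is inl _ then a - (t%:R - 1) else 1.
have t_pred : t.-1%:R = t%:R - 1 :> R by rewrite -subn1 natrB.
have n_pred : n.-1%:R = n%:R - 1 :> R by rewrite -subn1 natrB.
have yF v : \sum_(w in nbr v) y w = a * y v.
  under eq_bigl do rewrite inE.
  rewrite big_sumType /= big_sumType /=.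
  case: v => [i|[[i j]|[j lt_j]]]; last by exfalso; rewrite s0 in lt_j.
    rewrite big_pred0 ?add0r; last by move=> k; rewrite /= [i]ord1 [k]ord1.
    rewrite !sumr_const [X in _ + X](_ : _ = 0) ?addr0; last first.
      by rewrite -[_ *+ _]mulr_natl eq_card0 ?mul0r // => -[m]; rewrite s0.
    rewrite (_ : #|_| = n.-1) /y; last first.
      transitivity #|{: 'I_(n.-1 %/ t) * 'I_t}|; first exact: eq_card.
      by rewrite card_prod !card_ord.
    by rewrite /= aE n_pred.
  rewrite [X in _ + (_ + X)]big_pred0 // addr0 sumr_const card_ord mulr1n.
  rewrite sumr_const (_ : #|_| = t.-1).
    by rewrite /y t_pred; ring.
  transitivity #|[predX pred1 i & predC1 j]|; last first.
    by rewrite cardX card1 cardC1 card_ord mul1n.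
  apply: eq_card => -[i' j'].
  by rewrite !inE /= unfold_in /= !(eq_sym _ i) (eq_sym j').
apply/eigenvalue_adjacencyP; exists (y \o f).
  have [g fK gK] := bij_f; exists (g (inl ord0)); rewrite /= gK /y.
  apply/eqP => a0; move: aE; rewrite a0 mulr0 => /eqP.
  by rewrite eq_sym subr_eq0 pnatr_eq1 gtn_eqF.
move=> v; rewrite -yF [RHS](reindex f) /=; last exact/onW_bij.
by apply: eq_bigl => w; rewrite !inE ef.
Qed.

Theorem theorem3 (R : realType) (t n : nat) (G : sgraph)
    (ht : (4 <= t)%N) (hn : (400 * t ^ 6 <= n)%N) (hG : #|G| = n)
    (hminor : ~ minor (complete_bipartite 2 t) G) :
  let bound : R :=
    (t%:R - 1) / 2 + Num.sqrt (n%:R + (t%:R ^+ 2 - 2 * t%:R - 3) / 4) in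
  spectral_radius R G <= bound /\
  (spectral_radius R G = bound <-> n = 1 %[mod t] /\ giso G (Fgraph t n)).
Proof.
move=> bound; subst n; set n : R := #|G|%:R in bound *.
have t_ge4 : 4 <= t%:R :> R by rewrite ler_nat.
have G_gt1 : (1 < #|G|)%N.
  by apply: leq_trans hn; have : (0 < t ^ 6)%N; rewrite ?expn_gt0; lia.
have n_gt1 : 1 < n by rewrite ltr1n.
(* [bound] is the larger root of this quadratic equation, the form in which the estimates use it. *)
have boundE : bound * (bound - (t%:R - 1)) = n - 1.
  have := @sqr_sqrtr R (n + (t%:R ^+ 2 - 2 * t%:R - 3) / 4) ltac:(nra).
  rewrite /bound; set s := Num.sqrt _ => s2.
  transitivity (s ^+ 2 - (t%:R - 1) ^+ 2 / 4); first by field.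
  by rewrite s2; field.
have bound_gt0 : 0 < bound.
  by rewrite ltr_pwDl ?sqrtr_ge0 // divr_gt0 //; lra.
have bound_gt : t%:R - 1 < bound.
  by rewrite -subr_gt0 -(pmulr_rgt0 _ bound_gt0) boundE; lra.
have [eig_mu mu_max] := @spectral_radius_max R G (ltnW G_gt1).
set mu := spectral_radius R G in eig_mu mu_max *.
have [x [z [x_ge0 x_le1 xz mu_sub]]] := eigenvalue_subvector eig_mu.
have t_ge2 : (2 <= t)%N by apply: leq_trans ht.
(* By [boundE], [bound ^ 2] is [n - 1 + (t - 1) * bound], and the last product is at least 1. *)
have mu_large : bound <= mu -> n <= mu ^+ 2.
  move=> le_mu; apply: le_trans (_ : bound ^+ 2 <= _).
    by move: boundE; nra.
  by rewrite ler_pXn2r ?nnegrE ?(le_trans _ le_mu) // ltW.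
have mu_ge0 : bound <= mu -> 0 <= mu by apply: le_trans; apply: ltW.
have le_bound : mu <= bound.
  (* The quadratic increases beyond [t - 1], so [mu > bound] would push it above [n - 1], against
     [subeigen_le]. *)
  rewrite leNgt; apply/negP => lt_mu; have le_mu := ltW lt_mu.
  have := subeigen_le t_ge2 hn hminor x_ge0 x_le1 xz (mu_ge0 le_mu)
    (mu_large le_mu) mu_sub.
  by rewrite -/n -boundE; nra.
split=> //; split=> [mu_eq|[n1 isoG]]; last first.
  apply/le_anti; rewrite le_bound /=; apply: mu_max.
  exact: eigenvalue_Fgraph G_gt1 n1 isoG _ boundE.
have le_mu : bound <= mu by rewrite mu_eq.
have cone : forall v, v != z -> edge z v /\ #|nbr z :&: nbr v| = t.-1.
  apply: (subeigen_eq t_ge2 hn hminor x_ge0 x_le1 xz (mu_ge0 le_mu)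
    (mu_large le_mu) mu_sub).
  by rewrite mu_eq boundE.
have domz v : v != z -> edge z v by move/cone => [].
have regz v : v != z -> #|nbr z :&: nbr v| = t.-1 by move/cone => [].
split; first exact: (modn_regular_cone ht hminor domz regz).
exact: (giso_regular_cone ht hminor domz regz).
Qed.
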